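(* Let $L_1,L_2,L_3$ be any three distinct lines through the origin in $\mathbb{R}^2$. If $P,Q$ are elliptical distributions on $\mathbb{R}^2$ such that $P_{L_j}=Q_{L_j}$ for $j\in\{1,2,3\}$, then $P=Q$. (That is, an elliptical distribution in $\mathbb{R}^2$ is determined, among elliptical distributions, by its marginals along any three distinct lines.)
   Context: A Borel probability measure $P$ on $\mathbb{R}^d$ is an elliptical distribution if its characteristic function $\phi_P(\xi)=\int e^{ix\cdot\xi}\,dP(x)$ has the form $\phi_P(\xi)=e^{i\mu\cdot\xi}\psi(\xi^\top\Sigma\xi)$ for all $\xi\in\mathbb{R}^d$, where $\Sigma$ is a real (symmetric) positive semi-definite $d\times d$ matrix, $\mu\in\mathbb{R}^d$, and $\psi:[0,\infty)\to\mathbb{C}$ is continuous ($\mu,\Sigma,\psi$ may depend on $P$). For a one-dimensional vector subspace (line) $L\subset\mathbb{R}^d$ with orthogonal projection $\pi_L:\mathbb{R}^d\to L$, $P_L$ (the marginal of $P$ along $L$) denotes the Borel probability measure on $L$ given by $P_L(B)=P(\pi_L^{-1}(B))$. *)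

(* Defs.v *)
From HB Require Import structures.
From mathcomp Require Import all_boot all_order all_algebra.
From mathcomp Require Import all_classical all_reals all_analysis.
From mathcomp Require Import complex ring.

Set Implicit Arguments.
Unset Strict Implicit.
Unset Printing Implicit Defensive.

Import Order.TTheory GRing.Theory Num.Theory.
Import numFieldNormedType.Exports.

Local Open Scope classical_set_scope.
Local Open Scope ring_scope.
Local Open Scope complex_scope.

Definition borel (T : ptopologicalType) := g_sigma_algebraType (@open T).

HB.instance Definition _ (T : ptopologicalType) :=
  Measurable.on (borel T).

Section elliptical.
Context {R : realType}.

(* Vectors of R^d are row vectors, so xi^T Sigma xi reads xi *m Sigma *m xi^T. *)
Definition dot d (x y : 'rV[R]_d) : R := (x *m y^T) 0 0.

Definition expi (t : R) : R[i] := cos t +i* sin t.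

Definition Cintegral d (T : measurableType d) (P : probability T R)
    (f : T -> R[i]) : R[i] :=
  (\int[P]_x complex.Re (f x)) +i* (\int[P]_x complex.Im (f x)).

Definition char_fun d (P : probability (borel 'rV[R]_d) R)
    (xi : 'rV[R]_d) : R[i] :=
  Cintegral P (fun x => expi (dot x xi)).

Definition psdmx d (Sigma : 'M[R]_d) : Prop :=
  Sigma^T = Sigma /\ forall x : 'rV[R]_d, 0 <= dot (x *m Sigma) x.

(* R[i]^o is R[i] with the topology of its modulus; psi is only constrained,
   and only evaluated, on [0, +oo[. *)
Definition elliptical d (P : probability (borel 'rV[R]_d) R) : Prop :=
  exists (mu : 'rV[R]_d) (Sigma : 'M[R]_d) (psi : R -> R[i]^o),
  [/\ psdmx Sigma,
      {within `[0, +oo[, continuous psi} &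
      forall xi : 'rV[R]_d,
        char_fun P xi = expi (dot mu xi) * psi (dot (xi *m Sigma) xi)].

(* The points of L, with the topology induced by that of R^d. *)
Definition line_space d (L : {vspace 'rV[R]_d}) : Type :=
  initial_topology (vsval : subvs_of L -> 'rV[R]_d).

HB.instance Definition _ d (L : {vspace 'rV[R]_d}) :=
  Topological.copy (line_space L)
    (initial_topology (vsval : subvs_of L -> 'rV[R]_d)).

HB.instance Definition _ d (L : {vspace 'rV[R]_d}) :=
  isPointed.Build (line_space L) (0 : subvs_of L).

(* Orthogonal projection onto the line L = <[v]>: x |-> (x.v / v.v) v. It is
   meant for \dim L = 1; line_projP characterizes it independently of v. *)
Definition line_proj_vec d (L : {vspace 'rV[R]_d}) (x : 'rV[R]_d) : 'rV[R]_d :=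
  (dot x (vpick L) / dot (vpick L) (vpick L)) *: vpick L.

Definition line_proj d (L : {vspace 'rV[R]_d}) (x : borel 'rV[R]_d) :
    borel (line_space L) :=
  vsproj L (line_proj_vec L x).

Lemma dotE d (x y : 'rV[R]_d) : dot x y = \sum_i x 0 i * y 0 i.
Proof. by rewrite /dot mxE; apply: eq_bigr => i _; rewrite mxE. Qed.

Lemma dot_eq0 d (x : 'rV[R]_d) : (dot x x == 0) = (x == 0).
Proof.
rewrite dotE; apply/idP/eqP => [|->]; last first.
  by apply/eqP; rewrite big1// => i _; rewrite mxE mul0r.
rewrite psumr_eq0 => [/allP x0|i _]; last by rewrite -expr2 sqr_ge0.
apply/rowP => i; rewrite mxE; apply/eqP.
by have := x0 i (mem_index_enum i); rewrite /= mulf_eq0 orbb.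
Qed.

Lemma line_proj_vec_mem d (L : {vspace 'rV[R]_d}) (x : 'rV[R]_d) :
  line_proj_vec L x \in L.
Proof. by rewrite memvZ// memv_pick. Qed.

Lemma vsval_line_proj d (L : {vspace 'rV[R]_d}) (x : 'rV[R]_d) :
  vsval (line_proj L x : subvs_of L) = line_proj_vec L x.
Proof. by rewrite vsprojK// line_proj_vec_mem. Qed.

Lemma line_projP d (L : {vspace 'rV[R]_d}) (x p : 'rV[R]_d) : \dim L = 1%N ->
  (p = vsval (line_proj L x : subvs_of L)) <->
  (p \in L /\ forall y, y \in L -> dot (x - p) y = 0).
Proof.
move=> L1; rewrite vsval_line_proj.
have v0 : vpick L != 0 by rewrite vpick0 -dimv_eq0 L1.
have LE : L = <[vpick L]>%VS.
  apply/esym/eqP; rewrite eqEdim dim_vline v0 L1 andbT.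
  by rewrite -memvE memv_pick.
have vv0 : dot (vpick L) (vpick L) != 0 by rewrite dot_eq0.
have dBZ a b : dot (x - a *: vpick L) (b *: vpick L) =
    b * (dot x (vpick L) - a * dot (vpick L) (vpick L)).
  rewrite !dotE mulrBr !mulr_sumr -sumrB; apply: eq_bigr => i _.
  by rewrite !mxE; ring.
have LP y : y \in L -> exists a, y = a *: vpick L.
  by rewrite {1}LE => /vlineP.
split=> [->|[/LP[a ->] /(_ _ (memv_pick L))]].
  split=> [|y /LP[b ->]]; first exact: line_proj_vec_mem.
  by rewrite dBZ divfK// subrr mulr0.
rewrite -[X in dot _ X]scale1r dBZ mul1r => /eqP; rewrite subr_eq0 => /eqP xv.
by rewrite /line_proj_vec xv mulfK.
Qed.

Lemma dot_continuous d (v : 'rV[R]_d) : continuous (fun x => dot x v).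
Proof.
have -> : (fun x => dot x v) = (fun x => \sum_i x 0 i * v 0 i).
  by apply/funext => x; rewrite dotE.
move=> x; elim: (index_enum _) => [|i r IH].
  have -> : (fun y : 'rV[R]_d => \sum_(i <- [::]) y 0 i * v 0 i) = cst 0.
    by apply/funext => y; rewrite big_nil.
  exact: cst_continuous.
have -> : (fun y : 'rV[R]_d => \sum_(j <- i :: r) y 0 j * v 0 j) =
    (fun y => y 0 i * v 0 i + \sum_(j <- r) y 0 j * v 0 j).
  by apply/funext => y; rewrite big_cons.
by apply: cvgD IH; apply: cvgMr_tmp; exact: coord_continuous.
Qed.

Lemma line_proj_continuous d (L : {vspace 'rV[R]_d}) :
  continuous (line_proj_vec L).
Proof.
move=> x A [P xP PA]; rewrite nbhs_simpl/=.
have Fx : Filter (nbhs (x : 'rV[R]_d)) by exact: nbhs_filter.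
have : nbhs x (fun y => forall j, P 0 j (line_proj_vec L y 0 j)).
  apply: (@filter_forall _ _ (fun j y => P 0 j (line_proj_vec L y 0 j)) _ Fx) => j.
  suff : (fun y => line_proj_vec L y 0 j) @ x --> line_proj_vec L x 0 j.
    by apply; exact: xP.
  have -> : (fun y => line_proj_vec L y 0 j) = (fun y =>
      dot y (vpick L) / dot (vpick L) (vpick L) * vpick L 0 j).
    by apply/funext => y; rewrite mxE.
  by rewrite mxE; do 2 apply: cvgMr_tmp; exact: dot_continuous.
by apply: filterS => y Py; apply: PA => i j; rewrite ord1.
Qed.

Lemma measurable_line_proj d (L : {vspace 'rV[R]_d}) :
  measurable_fun [set: borel 'rV[R]_d] (line_proj L).
Proof.
apply: (@measurability _ _ _ (borel (line_space L)) _ _ (@open (line_space L))) => //.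
move=> _ [_ [A oA <-] <-]; rewrite setTI; apply: sub_sigma_algebra.
rewrite (_ : _ @^-1` _ = line_proj_vec L @^-1` A).
  by apply: open_comp => // x _; exact: line_proj_continuous.
by apply/seteqP; split=> x /=; rewrite vsval_line_proj.
Qed.

HB.instance Definition _ d (L : {vspace 'rV[R]_d}) :=
  isMeasurableFun.Build _ _ _ _ (line_proj L) (@measurable_line_proj d L).

(* marginal P L B is P (line_proj L @^-1` B). *)
Definition marginal d (P : probability (borel 'rV[R]_d) R)
    (L : {vspace 'rV[R]_d}) : probability (borel (line_space L)) R :=
  distribution P (line_proj L).

End elliptical.

(* Main.v *)
Require Import Defs.
From mathcomp Require Import all_boot all_order all_algebra.
From mathcomp Require Import all_classical all_reals all_analysis.
From mathcomp Require Import measurable_realfun complex ring lra.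
Import numFieldNormedType.Exports.
Import Order.TTheory GRing.Theory Num.Theory.
Set Implicit Arguments.
Unset Strict Implicit.
Unset Printing Implicit Defensive.
Local Open Scope ring_scope.
Local Open Scope classical_set_scope.

(** Write q for the quadratic form xi |-> xi Sigma xi^T of P, and p for its
    generator psi; T and r play the roles of Sigma and psi for Q.

    The marginal along a line is the same datum as the restriction of the
    characteristic function to that line ([char_fun_marginal]), so both
    characteristic functions agree on three lines, and since probability
    measures on R^d are determined by their characteristic functions
    ([char_fun_inj]) it remains to extend the equality to the whole plane.
    The generators are real on the values of q because phi(-xi) is the
    conjugate of phi(xi) ([elliptical_real]), and p(0) = r(0) = 1. Near the
    origin the factor p is nonzero, so the phases of the two characteristic
    functions agree and the two location vectors have the same inner product
    with the vectors of each line ([frequency_unique]), hence with all vectors.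

    What remains is p (s a_j) = r (s b_j) for s >= 0, where a_j and b_j are the
    values of the two quadratic forms at a vector of the j-th line.
    - If a_i b_j <> a_j b_i for some i, j, comparing the two lines gives
      p (k s) = p s for some k in [0, 1[; iterating and letting k^n s tend to 0
      shows that p is constant, and so is r by symmetry ([common_scaling]).
      Both laws are then the same point mass.
    - Otherwise the triples a and b are proportional. A quadratic form on the
      plane is determined by its values on three lines ([quad_three_lines]), so
      the two forms are proportional with the same ratio, and the relation
      between p and r is exactly the equality of the two characteristic
      functions.

    The uniqueness theorem for characteristic functions is obtained without
    Fourier inversion. Call f admissible when f dP and f dQ have the same
    Fourier transform ([fourier_equal]), and call m a multiplier when m f is
    admissible for each admissible f ([multiplier]). Waves
    x |-> cos (x.xi + c) are multipliers, and multipliers form an algebra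
    closed under bounded pointwise limits. Iterating the polynomial
    (3 w - w^3) / 2 turns sin ((x.e - b) / n) into its sign, and letting n go
    to infinity gives the sign of x.e - b: the indicators of half-spaces, hence
    those of Borel sets, are multipliers. Multiplying the admissible constant 1
    by the indicator of A and evaluating at frequency 0 gives P A = Q A. *)

(** * Bounded measurable functions *)

Section bounded_measurable.
Context {R : realType} {d : measure_display} {T : measurableType d}.
Implicit Types (f g : T -> R) (P : probability T R).

Definition bounded_mfun f :=
  measurable_fun setT f /\ exists M, forall x, `|f x| <= M.

Lemma bounded_mfun_cst (r : R) : bounded_mfun (cst r).
Proof. by split=> //; exists `|r|. Qed.

Lemma bounded_mfunD f g :
  bounded_mfun f -> bounded_mfun g -> bounded_mfun (fun x => f x + g x).
Proof.
move=> [mf [M fM]] [mg [N gN]]; split; first exact: measurable_funD.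
by exists (M + N) => x; rewrite (le_trans (ler_normD _ _))// lerD.
Qed.

Lemma bounded_mfunM f g :
  bounded_mfun f -> bounded_mfun g -> bounded_mfun (fun x => f x * g x).
Proof.
move=> [mf [M fM]] [mg [N gN]]; split; first exact: measurable_funM.
by exists (M * N) => x; rewrite normrM ler_pM.
Qed.

Lemma bounded_mfun_cvg (h : nat -> T -> R) f (M : R) :
  (forall n, measurable_fun setT (h n)) -> (forall n x, `|h n x| <= M) ->
  (forall x, h ^~ x @ \oo --> f x) -> bounded_mfun f.
Proof.
move=> mh hM hf; split; first by apply: (measurable_fun_cvg mh) => x _; exact: hf.
exists M => x; rewrite -(cvg_lim _ (cvg_norm (hf x)))//.
apply: limr_le; first by apply/cvg_ex; exists `|f x|; exact: cvg_norm.
by near=> n; exact: hM.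
Unshelve. all: by end_near. Qed.

Lemma bounded_mfun_integrable P f :
  bounded_mfun f -> P.-integrable setT (EFin \o f).
Proof.
move=> [mf [M fM]]; apply: measurable_bounded_integrable => //.
  exact: le_lt_trans (probability_le1 P measurableT) (ltry 1).
by exists M; split; rewrite ?num_real// => y My x _; exact: le_trans (fM x) (ltW My).
Qed.

Lemma bounded_cvg_Rintegral P (h : nat -> T -> R) f (M : R) :
  (forall n, measurable_fun setT (h n)) -> (forall n x, `|h n x| <= M) ->
  (forall x, h ^~ x @ \oo --> f x) ->
  \int[P]_x h n x @[n --> \oo] --> \int[P]_x f x.
Proof.
move=> mh hM hf.
have bf : bounded_mfun f by apply: bounded_mfun_cvg mh hM hf.
apply/fine_cvg; rewrite fineK; last first.
  exact/integrable_fin_num/bounded_mfun_integrable.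
apply: (@dominated_cvg _ _ _ P setT measurableT
  (fun n x => (h n x)%:E) (EFin \o f) (cst M%:E)) => //.
- by move=> n; exact/measurable_EFinP.
- by move=> x _; apply/fine_cvgP; split; [exact: nearW|exact: hf].
- exact: (bounded_mfun_integrable _ (bounded_mfun_cst M)).
- by move=> n x _; rewrite /= lee_fin.
Qed.

End bounded_measurable.

(** * A polynomial approximation of the sign *)

Section smooth_sign.
Context {R : realType}.
Implicit Type w : R.

(** The odd cubic with fixed points -1, 0, 1 and vanishing derivative at -1 and
    1: these are attracting and 0 is repelling, so its iterates sharpen into the
    sign function on [-1, 1]. *)
Definition smoothsign w : R := (3 * w - w ^+ 3) / 2.

Lemma smoothsign_itv w : 0 <= w <= 1 -> w <= smoothsign w <= 1.
Proof.
move=> /andP[w0 w1]; rewrite -subr_ge0 -[X in _ && X]subr_ge0.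
have -> : smoothsign w - w = w * ((1 - w) * (1 + w)) / 2.
  by rewrite /smoothsign; field.
have -> : 1 - smoothsign w = (1 - w) * (1 - w) * (2 + w) / 2.
  by rewrite /smoothsign; field.
by rewrite !mulr_ge0//; lra.
Qed.

Lemma smoothsignN w : smoothsign (- w) = - smoothsign w.
Proof. by rewrite /smoothsign; field. Qed.

Lemma iter_smoothsign_itv n w : 0 <= w <= 1 -> w <= iter n smoothsign w <= 1.
Proof.
elim: n => [|n IH] w01 /=; first by rewrite lexx; case/andP: w01.
have /andP[wi i1] := IH w01; have w0 : 0 <= w by case/andP: w01.
have /smoothsign_itv/andP[h ->] : 0 <= iter n smoothsign w <= 1.
  by rewrite i1 (le_trans w0).
by rewrite andbT (le_trans wi).
Qed.

Lemma iter_smoothsignN n w :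
  iter n smoothsign (- w) = - iter n smoothsign w.
Proof. by elim: n => //= n ->; rewrite smoothsignN. Qed.

Lemma iter_smoothsign_norm n w : `|w| <= 1 -> `|iter n smoothsign w| <= 1.
Proof.
wlog w0 : w / 0 <= w => [H|].
  case: (leP 0 w) => [|w0]; first exact: H.
  by rewrite -normrN -(normrN (iter _ _ _)) -iter_smoothsignN; apply: H; lra.
rewrite ger0_norm// => w1.
have /(iter_smoothsign_itv n)/andP[wi i1] : 0 <= w <= 1 by rewrite w0.
by rewrite ger0_norm//; lra.
Qed.

(** The distance to the attracting fixed point 1 is multiplied at each step by
    (1 - u) (2 + u) / 2 <= 1 - u / 2, which is at most 1 - w / 2 because the
    iterates u increase from w; convergence is therefore geometric. *)
Lemma cvg_iter_smoothsign w : `|w| <= 1 ->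
  iter n smoothsign w @[n --> \oo] --> Num.sg w.
Proof.
wlog w0 : w / 0 < w => [H w1|].
  case: (ltgtP 0 w) => [|w0|<-].
  - by move/H; apply.
  - rewrite -[w]opprK sgrN.
    under eq_fun do rewrite iter_smoothsignN.
    by apply: cvgN; apply: H; rewrite ?normrN//; lra.
  rewrite sgr0 (_ : (fun n => _) = cst 0); first exact: cvg_cst.
  by apply/funext => n; elim: n => //= n ->; rewrite /smoothsign; field.
rewrite gtr0_norm// gtr0_sg// => w1.
have w01 : 0 <= w <= 1 by rewrite ltW.
have k n : 1 - iter n smoothsign w <= (1 - w / 2) ^+ n.
  elim: n => [|n IH]; first by rewrite /= expr0; lra.
  have /andP[] := iter_smoothsign_itv n w01.
  move: IH; rewrite /= exprS; move: (iter n _ _) (_ ^+ n) => u e ue wu u1.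
  have -> : 1 - smoothsign u = (1 - u) * ((1 - u) * (2 + u) / 2).
    by rewrite /smoothsign; field.
  apply: (@le_trans _ _ ((1 - u) * (1 - w / 2))).
    by apply: ler_wpM2l; nra.
  by rewrite mulrC; apply: ler_wpM2l; lra.
apply: (@squeeze_cvgr _ _ _ _ (fun n => 1 - (1 - w / 2) ^+ n) (cst 1)).
- apply: nearW => n; have /andP[_ ->] := iter_smoothsign_itv n w01.
  by rewrite andbT; have := k n; lra.
- rewrite -[X in _ --> X]subr0; apply: cvgB; first exact: cvg_cst.
  by apply: cvg_expr; rewrite ger0_norm; lra.
- exact: cvg_cst.
Qed.

End smooth_sign.

(** * The dot product *)

Section dot_product.
Context {R : realType} {d : nat}.
Implicit Types (x y z : 'rV[R]_d).

Lemma dotDl x y z : dot (x + y) z = dot x z + dot y z.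
Proof. by rewrite /dot mulmxDl mxE. Qed.

Lemma dotZl (a : R) x y : dot (a *: x) y = a * dot x y.
Proof. by rewrite /dot -scalemxAl mxE. Qed.

Lemma dotC x y : dot x y = dot y x.
Proof. by rewrite !dotE; apply: eq_bigr => i _; rewrite mulrC. Qed.

Lemma dotDr x y z : dot x (y + z) = dot x y + dot x z.
Proof. by rewrite dotC dotDl !(dotC _ x). Qed.

Lemma dotZr (a : R) x y : dot x (a *: y) = a * dot x y.
Proof. by rewrite dotC dotZl dotC. Qed.

Lemma dotNr x y : dot x (- y) = - dot x y.
Proof. by rewrite -scaleN1r dotZr mulN1r. Qed.

Lemma dotNl x y : dot (- x) y = - dot x y.
Proof. by rewrite dotC dotNr dotC. Qed.

Lemma dot0r x : dot x 0 = 0.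
Proof. by rewrite -(scale0r 0) dotZr mul0r. Qed.

End dot_product.

(** * Sines and Borel functions *)

Lemma sgr_sin (R : realType) (t : R) : `|t| <= 1 -> Num.sg (sin t) = Num.sg t.
Proof.
wlog t0 : t / 0 < t => [H t1|].
  case: (ltgtP 0 t) => [t0|t0|<-]; [exact: H| |by rewrite sin0].
  apply: oppr_inj; rewrite -!sgrN -sinN.
  by apply: H; rewrite ?normrN ?oppr_gt0.
rewrite gtr0_norm// => t1; rewrite !gtr0_sg// sin_gt0_pi// t0/=.
by have := @pi_ge2 R; lra.
Qed.

Lemma continuous_borel_measurable (R : realType) (T : ptopologicalType)
    (f : T -> R) : continuous f -> measurable_fun [set: borel T] f.
Proof.
move=> /continuousP cf; apply: (measurability _ (RGenOpens.measurableE R)).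
move=> _ [_ [a [b ->] <-]]; rewrite setTI; apply: sub_sigma_algebra.
exact/cf/interval_open.
Qed.

(** * Multipliers of functions with equal Fourier transforms *)

Section multipliers.
Context {R : realType} {d : nat} (P Q : probability (borel 'rV[R]_d) R).
Implicit Types (f g m : borel 'rV[R]_d -> R) (xi e : 'rV[R]_d).

(** The phase c packs the real and imaginary parts of the Fourier transforms of
    f dP and f dQ into one family of real equations. *)
Definition fourier_equal f := bounded_mfun f /\ forall xi c,
  \int[P]_x (f x * cos (dot x xi + c)) = \int[Q]_x (f x * cos (dot x xi + c)).

Definition multiplier m := bounded_mfun m /\
  forall f, fourier_equal f -> fourier_equal (fun x => m x * f x).

Lemma bounded_mfun_wave xi c :
  bounded_mfun (fun x : borel 'rV[R]_d => cos (dot x xi + c)).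
Proof.
split; last by exists 1 => x; rewrite ler_norml cos_geN1 cos_le1.
apply: (@measurableT_comp _ _ _ _ _ _ cos).
  exact: continuous_measurable_fun (@continuous_cos R).
apply: measurable_funD => //.
exact: continuous_borel_measurable (@dot_continuous R d xi).
Qed.

Lemma bounded_mfun_mul_wave xi c f : bounded_mfun f ->
  bounded_mfun (fun x => f x * cos (dot x xi + c)).
Proof. by move=> bf; exact: bounded_mfunM bf (bounded_mfun_wave xi c). Qed.

(** The product of two cosines is the average of the cosines of the sum and of
    the difference of the phases, so multiplying by a wave only translates the
    frequencies, over which the equality already ranges. *)
Lemma fourier_equal_wave f eta c : fourier_equal f ->
  fourier_equal (fun x => cos (dot x eta + c) * f x).
Proof.
move=> [bf fE]; split; first exact: bounded_mfunM (bounded_mfun_wave _ _) bf.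
move=> xi c'.
have E (S : probability (borel 'rV[R]_d) R) :
    \int[S]_x (cos (dot x eta + c) * f x * cos (dot x xi + c')) =
    2^-1 * (\int[S]_x (f x * cos (dot x (xi + eta) + (c' + c))) +
            \int[S]_x (f x * cos (dot x (xi - eta) + (c' - c)))).
  have I xi0 c0 := bounded_mfun_integrable S (bounded_mfun_mul_wave xi0 c0 bf).
  rewrite -RintegralD// -RintegralZl//; last first.
    by apply/bounded_mfun_integrable/bounded_mfunD; exact: bounded_mfun_mul_wave.
  apply: eq_Rintegral => x _.
  have -> : dot x (xi + eta) + (c' + c) = (dot x xi + c') + (dot x eta + c).
    by rewrite dotDr; ring.
  have -> : dot x (xi - eta) + (c' - c) = (dot x xi + c') - (dot x eta + c).
    by rewrite dotDr dotNr; ring.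
  move: (dot x xi + c') (dot x eta + c) => u v.
  by rewrite cosD cosB; field.
by rewrite !E !fE.
Qed.

Lemma fourier_equalD f g : fourier_equal f -> fourier_equal g ->
  fourier_equal (fun x => f x + g x).
Proof.
move=> [bf fE] [bg gE]; split=> [|xi c]; first exact: bounded_mfunD.
have E (S : probability (borel 'rV[R]_d) R) :
    \int[S]_x ((f x + g x) * cos (dot x xi + c)) =
    \int[S]_x (f x * cos (dot x xi + c)) + \int[S]_x (g x * cos (dot x xi + c)).
  rewrite -RintegralD//.
  - by apply: eq_Rintegral => x _; rewrite mulrDl.
  - exact/bounded_mfun_integrable/bounded_mfun_mul_wave.
  - exact/bounded_mfun_integrable/bounded_mfun_mul_wave.
by rewrite !E fE gE.
Qed.

Lemma fourier_equalZ (r : R) f : fourier_equal f ->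
  fourier_equal (fun x => r * f x).
Proof.
move=> [bf fE]; split=> [|xi c].
  exact: bounded_mfunM (bounded_mfun_cst r) bf.
have E (S : probability (borel 'rV[R]_d) R) :
    \int[S]_x (r * f x * cos (dot x xi + c)) =
    r * \int[S]_x (f x * cos (dot x xi + c)).
  rewrite -RintegralZl//.
  - by apply: eq_Rintegral => x _; rewrite mulrA.
  - exact/bounded_mfun_integrable/bounded_mfun_mul_wave.
by rewrite !E fE.
Qed.

Lemma fourier_equal_cvg (h : nat -> borel 'rV[R]_d -> R) f (M : R) :
  (forall n, fourier_equal (h n)) -> (forall n x, `|h n x| <= M) ->
  (forall x, h ^~ x @ \oo --> f x) -> fourier_equal f.
Proof.
move=> hE hM hf; split=> [|xi c].
  by apply: bounded_mfun_cvg hM hf => n; have [[]] := hE n.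
have C (S : probability (borel 'rV[R]_d) R) :
    \int[S]_x (h n x * cos (dot x xi + c)) @[n --> \oo] -->
    \int[S]_x (f x * cos (dot x xi + c)).
  apply: (@bounded_cvg_Rintegral _ _ _ S _ _ M).
  - move=> n; have [[mh _] _] := hE n.
    by apply: measurable_funM => //; have [] := bounded_mfun_wave xi c.
  - move=> n x; rewrite normrM (le_trans _ (hM n x))// ler_piMr//.
    by rewrite ler_norml cos_geN1 cos_le1.
  - by move=> x; apply: cvgM (hf x) (cvg_cst _).
have := C P; rewrite (_ : (fun n => _) =
    fun n => \int[Q]_x (h n x * cos (dot x xi + c))).
  by move=> CP; apply: cvg_unique CP (C Q).
by apply/funext => n; have [_] := hE n.
Qed.

Lemma multiplier_cst (r : R) : multiplier (fun=> r).
Proof.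
split; [exact: bounded_mfun_cst|by move=> f; exact: fourier_equalZ].
Qed.

Lemma multiplier_wave xi c : multiplier (fun x => cos (dot x xi + c)).
Proof. by split=> [|f]; [exact: bounded_mfun_wave|exact: fourier_equal_wave]. Qed.

Lemma multiplierD m1 m2 : multiplier m1 -> multiplier m2 ->
  multiplier (fun x => m1 x + m2 x).
Proof.
move=> [b1 M1] [b2 M2]; split; first exact: bounded_mfunD.
move=> f fE; under eq_fun do rewrite mulrDl.
by apply: fourier_equalD; [exact: M1|exact: M2].
Qed.

Lemma multiplierM m1 m2 : multiplier m1 -> multiplier m2 ->
  multiplier (fun x => m1 x * m2 x).
Proof.
move=> [b1 M1] [b2 M2]; split; first exact: bounded_mfunM.
by move=> f fE; under eq_fun do rewrite -mulrA; apply/M1/M2.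
Qed.

Lemma multiplier_cvg (h : nat -> borel 'rV[R]_d -> R) m (M : R) :
  (forall n, multiplier (h n)) -> (forall n x, `|h n x| <= M) ->
  (forall x, h ^~ x @ \oo --> m x) -> multiplier m.
Proof.
move=> hm hM hf; split.
  by apply: bounded_mfun_cvg hM hf => n; have [[]] := hm n.
move=> f fE; have [[_ [N fN]] _] := fE.
apply: (@fourier_equal_cvg (fun n x => h n x * f x) _ (M * N)).
- by move=> n; have [_] := hm n; exact.
- by move=> n x; rewrite normrM ler_pM.
- by move=> x; apply: cvgM (hf x) (cvg_cst _).
Qed.

(** Two limits are needed: sharpening the smooth sign of sin (t (x.e - b)) gives
    a square wave, and as its period tends to infinity it agrees, at each x,
    with the sign of x.e - b from some point on. *)
Lemma multiplier_sg e (b : R) : multiplier (fun x => Num.sg (dot x e - b)).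
Proof.
have sinle1 (t : R) : `|sin t| <= 1 by rewrite ler_norml sin_geN1 sin_le1.
have M1 (t : R) : multiplier (fun x => Num.sg (sin (t * (dot x e - b)))).
  apply: (@multiplier_cvg
    (fun n x => iter n smoothsign (sin (t * (dot x e - b)))) _ 1).
  - elim=> [|n IH] /=.
      rewrite (_ : (fun x => _) =
          fun x => cos (dot x (t *: e) + (- (t * b) - pi / 2))).
        exact: multiplier_wave.
      by apply/funext => x; rewrite dotZr addrA cosBpihalf mulrBr.
    have H := multiplierM IH (multiplierD (multiplier_cst (3 / 2))
      (multiplierM (multiplier_cst (- 2^-1)) (multiplierM IH IH))).
    have E u : smoothsign u = u * (3 / 2 + - 2^-1 * (u * u)) :> R.
      by rewrite /smoothsign; field.
    by under eq_fun do rewrite E.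
  - by move=> n x; exact: iter_smoothsign_norm.
  - by move=> x; exact: cvg_iter_smoothsign.
apply: (@multiplier_cvg
  (fun n x => Num.sg (sin (n.+1%:R^-1 * (dot x e - b)))) _ 1) => //.
- by move=> n x; rewrite normr_sg; case: (_ != 0).
- move=> x; set t := dot x e - b.
  apply: cvg_near_cst; near=> n.
  have n0 : (0 : R) < n.+1%:R^-1 by rewrite invr_gt0.
  rewrite sgr_sin; first by rewrite sgrM gtr0_sg// mul1r.
  rewrite normrM gtr0_norm// ler_pdivrMl// mulr1.
  near: n; exists (Num.bound `|t|) => // n /= tn.
  apply: le_trans (ltW (archi_boundP (normr_ge0 t))) _.
  by rewrite ler_nat leqW.
Unshelve. all: by end_near. Qed.

(** Complements come from 1 - m, and the complement of a countable union from
    the limit of the finite products of the complements 1 - m_k. *)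
Lemma sigma_algebra_multiplier :
  sigma_algebra setT [set A | multiplier (\1_A : borel 'rV[R]_d -> R)].
Proof.
have C A : multiplier (\1_A : borel 'rV[R]_d -> R) ->
    multiplier (fun x => 1 - \1_A x).
  move=> mA; have := multiplierD (multiplier_cst 1)
    (multiplierM (multiplier_cst (-1)) mA).
  by under eq_fun do rewrite mulN1r.
split=> /=.
- by rewrite indic0; exact: multiplier_cst.
- move=> A /C; rewrite (_ : (fun x => _) = \1_(setT `\` A))//.
  by apply/funext => x; rewrite setTD !indicE in_setC; case: (x \in A);
    rewrite ?subrr ?subr0.
- move=> A mA.
  have mU : multiplier (fun x => 1 - \1_(~` \bigcup_k A k) x).
    apply: (C).
    apply: (@multiplier_cvg (fun n x => \prod_(k < n) (1 - \1_(A k) x)) _ 1).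
    + elim=> [|n IH].
        by under eq_fun do rewrite big_ord0; exact: multiplier_cst.
      under eq_fun do rewrite big_ord_recr.
      exact: multiplierM IH (C _ (mA n)).
    + move=> n x; rewrite normr_prod; apply: prodr_ile1 => k _.
      rewrite normr_ge0 indicE /=.
      by case: (x \in A k); rewrite ?subrr ?subr0 ?normr0 ?normr1.
    + move=> x; apply: cvg_near_cst.
      have [[k _ Akx]|nA] := pselect ((\bigcup_k A k) x).
        exists k.+1 => // n /= kn; rewrite (bigD1 (Ordinal kn))//= !indicE.
        rewrite mem_set// subrr mul0r memNset//; apply; by exists k.
      apply: nearW => n; rewrite indicE mem_set// big1// => k _.
      by rewrite indicE memNset ?subr0// => Akx; apply: nA; exists k.
  rewrite (_ : \1_ _ = (fun x => 1 - \1_(~` \bigcup_k A k) x))//.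
  apply/funext => x; rewrite !indicE in_setC.
  by case: (x \in _); rewrite ?subrr ?subr0.
Qed.

Lemma multiplier_half_space e (b : R) :
  multiplier (\1_[set x | b < dot x e] : borel 'rV[R]_d -> R).
Proof.
have S := multiplier_sg e b.
(* (w + w^2) / 2 maps the signs -1, 0, 1 to 0, 0, 1. *)
have := multiplierM (multiplier_cst 2^-1) (multiplierD S (multiplierM S S)).
rewrite (_ : (fun x => _) = \1_[set x | b < dot x e])//.
apply/funext => x; rewrite indicE.
case: (ltgtP (dot x e) b) => h.
- by rewrite ltr0_sg ?subr_lt0// memNset ?mulr0n; [ring|rewrite /= ltNge ltW].
- by rewrite gtr0_sg ?subr_gt0// mem_set//=; field.
- by rewrite h subrr sgr0 memNset ?mulr0n; [ring|rewrite /= h ltxx].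
Qed.

End multipliers.

(** * Uniqueness of characteristic functions *)

Section borel_half_spaces.
Context {R : realType} {d : nat}.

Definition half_spaces : set (set 'rV[R]_d) :=
  [set A | exists e b, A = [set x | b < dot x e]].

(** An open set is the union of the cubes with rational centre and radius
    1 / (n + 1) that it contains; a cube is a finite intersection of
    half-spaces. *)
Lemma open_half_spaces (A : set 'rV[R]_d) : open A -> <<s half_spaces >> A.
Proof.
move=> oA.
pose cube (q : 'rV[rat]_d) (n : nat) : set 'rV[R]_d :=
  [set y | forall j, `|y 0 j - ratr (q 0 j)| < n.+1%:R^-1].
have coordE (y : 'rV[R]_d) j : y 0 j = dot y (delta_mx 0 j).
  rewrite dotE (bigD1 j)//= mxE !eqxx mulr1 big1 ?addr0// => i ij.
  by rewrite mxE (negbTE ij) andbF mulr0.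
have mcube q n : @measurable _ (g_sigma_algebraType half_spaces) (cube q n).
  rewrite (_ : cube q n = \bigcap_(j in [set: 'I_d])
    ([set y | ratr (q 0 j) - n.+1%:R^-1 < dot y (delta_mx 0 j)] `&`
     [set y | - ratr (q 0 j) - n.+1%:R^-1 < dot y (- delta_mx 0 j)])).
    apply: fin_bigcap_measurable => // j _; apply: measurableI;
      by apply: sub_sigma_algebra; do 2 eexists.
  apply/seteqP; split=> y /=.
    move=> yq j _ /=; have := yq j; rewrite dotNr -coordE ltr_norml.
    by move: (y 0 j) (ratr _) (_^-1) => u v w /andP[]; split; lra.
  move=> yq j; have [] := yq j I; rewrite /= dotNr -coordE ltr_norml.
  by move: (y 0 j) (ratr _) (_^-1) => u v w h1 h2; apply/andP; split; lra.
pose F (p : 'rV[rat]_d * nat) : set 'rV[R]_d :=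
  if pselect (cube p.1 p.2 `<=` A) then cube p.1 p.2 else set0.
have -> : A = \bigcup_p F p.
  apply/seteqP; split=> [x Ax|x [p _]]; last first.
    by rewrite /F; case: pselect => // pA /pA.
  have : nbhs x A by exact: open_nbhs_nbhs.
  rewrite -nbhs_ballE => -[r /= r0 rA].
  (* Two points of a cube of radius 1 / (n + 1) differ by less than
     2 / (n + 1) in each coordinate. *)
  pose n := Num.bound (2 / r).
  have nr : 2 * n.+1%:R^-1 < r.
    rewrite ltr_pdivrMr// mulrC -ltr_pdivrMr//.
    apply: lt_le_trans (archi_boundP _) _; first by rewrite divr_ge0 ?ltW.
    by rewrite ler_nat.
  have n0 : (0 : R) < n.+1%:R^-1 by rewrite invr_gt0.
  have xq j : exists q : rat, `|x 0 j - ratr q| < n.+1%:R^-1.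
    have /rat_in_itvoo[q] : x 0 j - n.+1%:R^-1 < x 0 j + n.+1%:R^-1.
      by rewrite ltrBlDr -addrA ltrDl addr_gt0.
    rewrite in_itv /= => /andP[h1 h2]; exists q.
    by rewrite ltr_distlC; apply/andP.
  pose q : 'rV[rat]_d := \row_j sval (cid (xq j)).
  exists (q, n) => //; rewrite /F /=.
  have xc : cube q n x by move=> j; rewrite mxE; exact: svalP (cid (xq j)).
  case: pselect => // nA; exfalso; apply: nA => y yc; apply: rA.
  split=> // i j; rewrite ord1 /ball /=.
  apply: le_lt_trans nr; rewrite mulr_natl mulr2n.
  apply: le_trans (ler_distD (ratr (q 0 j)) _ _) _.
  by apply: lerD; rewrite ltW// distrC.
apply: (@countable_bigcupT_measurable _ (g_sigma_algebraType half_spaces)) => //.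
move=> p; rewrite /F; case: pselect => [pA|pA]; first exact: mcube.
exact: measurable0.
Qed.

Theorem char_fun_inj (P Q : probability (borel 'rV[R]_d) R) :
  char_fun P =1 char_fun Q ->
  forall A : set (borel 'rV[R]_d), measurable A -> P A = Q A.
Proof.
move=> PQ A mA.
have mult1 : multiplier P Q (\1_A : borel 'rV[R]_d -> R).
  have salg := sigma_algebra_multiplier P Q.
  apply: (smallest_sub salg _ mA) => B /open_half_spaces.
  by apply: (smallest_sub salg) => _ [e [b ->]]; exact: multiplier_half_space.
have fe1 : fourier_equal P Q (fun=> 1).
  split; first exact: bounded_mfun_cst.
  move=> xi c; have E (S : probability (borel 'rV[R]_d) R) :
      \int[S]_x (1 * cos (dot x xi + c)) =
      cos c * complex.Re (char_fun S xi) - sin c * complex.Im (char_fun S xi).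
    rewrite /char_fun /Cintegral /=.
    have Is : S.-integrable setT (EFin \o (fun x => sin (dot x xi))).
      apply: eq_integrable (bounded_mfun_integrable S
        (bounded_mfun_wave xi (- (pi / 2)))) => // x _.
      by rewrite /= cosBpihalf.
    have Ic : S.-integrable setT (EFin \o (fun x => cos (dot x xi))).
      apply: eq_integrable (bounded_mfun_integrable S
        (bounded_mfun_wave xi 0)) => // x _.
      by rewrite /= addr0.
    rewrite -!RintegralZl// -RintegralB//.
    - by apply: eq_Rintegral => x _; rewrite mul1r cosD; ring.
    - by apply: eq_integrable (integrableZl _ (cos c) Ic).
    - by apply: eq_integrable (integrableZl _ (sin c) Is).
  by rewrite !E PQ.
have [_ /(_ _ fe1)[_ PQA]] := mult1; have := PQA 0 0.
have E (S : probability (borel 'rV[R]_d) R) :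
    \int[S]_x (\1_A x * 1 * cos (dot x 0 + 0)) = fine (S A).
  rewrite /Rintegral -[A in RHS]setIT -integral_indic//; congr fine.
  by apply: eq_integral => x _; rewrite dot0r addr0 cos0 !mulr1.
rewrite !E => PA; rewrite -[LHS]fineK ?fin_num_measure//.
by rewrite PA fineK// fin_num_measure.
Qed.

End borel_half_spaces.

(** * Marginals and restrictions of the characteristic function *)

Section marginals.
Context {R : realType} {d : nat}.
Implicit Types (P Q : probability (borel 'rV[R]_d) R) (L : {vspace 'rV[R]_d}).

Lemma continuous_vsval_dot L (xi : 'rV[R]_d) (g : R -> R) : continuous g ->
  continuous (fun y : line_space L => g (dot (vsval (y : subvs_of L)) xi)).
Proof.
move=> cg y; apply: (@continuous_comp _ _ _
  (fun y : line_space L => dot (vsval (y : subvs_of L)) xi)); last exact: cg.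
apply: (@continuous_comp _ _ _
  (vsval : line_space L -> 'rV[R]_d) (fun x => dot x xi)).
  exact: initial_continuous.
exact: dot_continuous.
Qed.

(** Projecting x orthogonally onto L does not change its dot product with a
    vector of L. *)
Lemma Rintegral_marginal P L (xi : 'rV[R]_d) (g : R -> R) :
  \dim L = 1%N -> xi \in L -> continuous g -> (forall t, `|g t| <= 1) ->
  \int[P]_x g (dot x xi) =
  \int[marginal P L]_y g (dot (vsval (y : subvs_of L)) xi).
Proof.
move=> L1 xiL cg g1.
have E x : dot x xi = dot (vsval (line_proj L x : subvs_of L)) xi.
  have [/(_ erefl)[_ /(_ xi xiL)]] :=
    line_projP x (vsval (line_proj L x : subvs_of L)) L1.
  by rewrite dotDl dotNl => /eqP; rewrite subr_eq0 => /eqP.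
have mg : measurable_fun [set: borel (line_space L)]
    (fun y => g (dot (vsval (y : subvs_of L)) xi)).
  exact: continuous_borel_measurable (continuous_vsval_dot cg).
rewrite /Rintegral /marginal integral_distribution; first last.
- apply: (@bounded_mfun_integrable _ _ _ P
    (fun x => g (dot (vsval (line_proj L x : subvs_of L)) xi))).
  split; last by exists 1 => x; exact: g1.
  by apply: (measurableT_comp mg); exact: measurable_line_proj.
- exact/measurable_EFinP.
by congr fine; apply: eq_integral => x _ /=; rewrite {1}E.
Qed.

Lemma char_fun_marginal P Q L : \dim L = 1%N ->
  (forall B : set (borel (line_space L)),
     measurable B -> marginal P L B = marginal Q L B) ->
  {in L, char_fun P =1 char_fun Q}.
Proof.
move=> L1 PQ xi xiL; rewrite /char_fun /Cintegral /=.
have E g : continuous g -> (forall t : R, `|g t| <= 1) ->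
    \int[P]_x g (dot x xi) = \int[Q]_x g (dot x xi).
  move=> cg g1; rewrite !(Rintegral_marginal _ L1 xiL cg g1); congr fine.
  by apply: eq_measure_integral => B mB _; exact: PQ.
rewrite (E cos) ?(E sin)//; try exact: continuous_cos; try exact: continuous_sin.
  by move=> t; rewrite ler_norml sin_geN1 sin_le1.
by move=> t; rewrite ler_norml cos_geN1 cos_le1.
Qed.

End marginals.

(** * Real generators of elliptical distributions *)

Section real_generator.
Context {R : realType} {d : nat}.
Implicit Type P : probability (borel 'rV[R]_d) R.

Lemma char_fun0 P : char_fun P 0 = 1.
Proof.
rewrite /char_fun /Cintegral /=.
under eq_Rintegral do rewrite dot0r cos0.
under [X in (_ +i* X)%C]eq_Rintegral do rewrite dot0r sin0.
rewrite !Rintegral_cst// mul0r mul1r.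
have -> : fine (P setT) = 1 by rewrite probability_setT.
by [].
Qed.

Lemma char_funN P xi : char_fun P (- xi) = ((char_fun P xi)^*)%C.
Proof.
rewrite /char_fun /Cintegral /=; congr (_ +i* _)%C.
  by apply: eq_Rintegral => x _; rewrite dotNr cosN.
rewrite -mulN1r -RintegralZl//.
  by apply: eq_Rintegral => x _; rewrite dotNr sinN mulN1r.
apply: eq_integrable (bounded_mfun_integrable P
  (bounded_mfun_wave xi (- (pi / 2)))) => // x _.
by rewrite /= cosBpihalf.
Qed.

(** A quadratic form is even, so phi(-xi) = conj phi(xi) forces psi to be real on
    the values of the form. Its real part p then serves as generator, and
    inherits right continuity at 0 from psi. *)
Lemma elliptical_real P : elliptical P ->
  exists (mu : 'rV[R]_d) (Sigma : 'M[R]_d) (p : R -> R),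
  [/\ psdmx Sigma, p 0 = 1, p s @[s --> 0^'+] --> p 0 &
      forall xi, char_fun P xi =
        (cos (dot mu xi) * p (dot (xi *m Sigma) xi)
         +i* (sin (dot mu xi) * p (dot (xi *m Sigma) xi)))%C].
Proof.
move=> [mu [Sigma [psi [psdS cpsi PE]]]].
exists mu, Sigma, (fun s => complex.Re (psi s)).
have psi0 : psi 0 = 1.
  have := PE 0; rewrite char_fun0 mul0mx !dot0r /expi cos0 sin0.
  by rewrite (_ : (1 +i* 0)%C = 1)// mul1r.
split=> // [|/=|xi]; first by rewrite psi0.
  have /continuous_within_itvcyP[_ /cvgrPdist_lt psi_cvg] := cpsi.
  apply/cvgrPdist_lt => e e0; near=> s.
  have : `|psi 0 - psi s| < e%:C%C by near: s; apply: psi_cvg; rewrite ltcR.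
  move=> /(le_lt_trans (normc_ge_Re _)); rewrite ltcR.
  by rewrite raddfB.
rewrite PE.
suff -> : psi (dot (xi *m Sigma) xi) =
    (complex.Re (psi (dot (xi *m Sigma) xi)))%:C%C.
  by rewrite /expi; apply/eqP; rewrite eq_complex /= !mulr0 subr0 add0r !eqxx.
have := char_funN P xi; rewrite !PE mulNmx dotNl !dotNr opprK.
case: (psi _) => a b; rewrite /expi cosN sinN.
move=> /eqP; rewrite eq_complex /= => /andP[/eqP h1 /eqP h2].
have := cos2Dsin2 (dot mu xi); move: h1 h2; move: (cos _) (sin _) => u v h1 h2 uv.
suff -> : b = 0 by [].
have vb : v * b = 0 by lra.
have ub : u * b = 0 by lra.
by rewrite -[b]mul1r -uv mulrDl !expr2 -!mulrA ub vb !mulr0 addr0.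
Unshelve. all: by end_near. Qed.

End real_generator.

(** * Comparison of two generators along lines *)

Section right_continuous_at0.
Context {R : realType}.
Implicit Types p r : R -> R.

Lemma scaling_invariant_cst p (k : R) : p s @[s --> 0^'+] --> p 0 ->
  0 <= k < 1 -> (forall s, 0 <= s -> p (k * s) = p s) ->
  forall s, 0 <= s -> p s = p 0.
Proof.
move=> p0 /andP[k0 k1] pk s; rewrite le_eqVlt => /predU1P[<-//|s0].
move: k0; rewrite le_eqVlt => /predU1P[k0|k0].
  by rewrite -(pk s) ?ltW// -k0 mul0r.
have pn n : p (k ^+ n * s) = p s.
  elim: n => [|n IH]; first by rewrite expr0 mul1r.
  by rewrite exprS -mulrA pk// mulr_ge0 ?exprn_ge0// ltW.
have /cvg_at_rightP/(_ (fun n => k ^+ n * s)) := p0.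
have H : (forall n, 0 < k ^+ n * s) /\ k ^+ n * s @[n --> \oo] --> 0.
  split=> [n|]; first by rewrite mulr_gt0// exprn_gt0.
  rewrite -[X in _ --> X](mul0r s); apply: cvgM; last exact: cvg_cst.
  by apply: cvg_expr; rewrite gtr0_norm.
move=> /(_ H); under eq_fun do rewrite pn.
by move=> /(cvg_unique (@Rhausdorff R) (cvg_cst _)).
Qed.

(** The two relations, taken at s b' and at s b, give p (s b' a) = r (s b' b) =
    p (s b a'), so p is invariant under the ratio of a b' and a' b, taken in the
    order that makes it less than 1. *)
Lemma common_scaling p r (a b a' b' : R) :
  p s @[s --> 0^'+] --> p 0 -> 0 <= a -> 0 <= b -> 0 <= a' -> 0 <= b' ->
  (forall s, 0 <= s -> p (s * a) = r (s * b)) ->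
  (forall s, 0 <= s -> p (s * a') = r (s * b')) ->
  a * b' != a' * b -> forall s, 0 <= s -> p s = p 0.
Proof.
move=> p0; wlog lt : a b a' b' / a * b' < a' * b => [H|].
  move=> a0 b0 a'0 b'0 h h' ne.
  have [lt|lt|/eqP] := ltgtP (a * b') (a' * b); last by rewrite (negbTE ne).
    exact: (H a b a' b').
  by apply: (H a' b' a b) => //; rewrite eq_sym.
move=> a0 b0 a'0 b'0 h h' _.
have c0 : 0 < a' * b by apply: le_lt_trans lt; exact: mulr_ge0.
apply: (@scaling_invariant_cst p (a * b' / (a' * b))) => //.
  by rewrite divr_ge0 ?mulr_ge0//= ltr_pdivrMr// mul1r.
move=> s s0; pose t := s / (a' * b).
have t0 : 0 <= t by rewrite divr_ge0// ltW.
have -> : a * b' / (a' * b) * s = t * b' * a by rewrite /t; ring.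
have -> : s = t * b * a' by rewrite /t -mulrA (mulrC b) divfK// gt_eqF.
rewrite h; last exact: mulr_ge0.
rewrite h'; last exact: mulr_ge0.
by congr r; ring.
Qed.

(** Eliminating r between the two equations leaves
    sin (t (u - v)) p (t^2 a) = 0. If u <> v, this fails for small t > 0, for
    which p (t^2 a) is close to p 0 = 1 and 0 < |t (u - v)| <= 1. *)
Lemma frequency_unique p r (a b u v : R) :
  p 0 = 1 -> p s @[s --> 0^'+] --> p 0 -> 0 <= a ->
  (forall t, cos (t * u) * p (t ^+ 2 * a) = cos (t * v) * r (t ^+ 2 * b)) ->
  (forall t, sin (t * u) * p (t ^+ 2 * a) = sin (t * v) * r (t ^+ 2 * b)) ->
  u = v.
Proof.
move=> p01 /cvgrPdist_lt/(_ 1 ltr01)[e /= e0 pe] a0 hc hs; apply/eqP.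
rewrite -subr_eq0; apply/negPn/negP => uv0.
have a1 : 0 < a + 1 by lra.
(* The three bounds on t give t^2 a <= t a < e and |t (u - v)| <= 1. *)
pose t := Num.min 1 (Num.min `|u - v|^-1 (e / (a + 1))).
have t0 : 0 < t by rewrite !lt_min ltr01 invr_gt0 normr_gt0 uv0 divr_gt0.
have t1 : t <= 1 by rewrite /t ge_min lexx.
have tuv : `|t * (u - v)| <= 1.
  rewrite normrM (gtr0_norm t0) -ler_pdivlMr ?normr_gt0// mul1r.
  by rewrite /t !ge_min lexx orbT.
have te : t * (a + 1) <= e.
  by rewrite -ler_pdivlMr// /t !ge_min lexx !orbT.
have ptne0 : p (t ^+ 2 * a) != 0.
  move: a0; rewrite le_eqVlt => /predU1P[<-|a0].
    by rewrite mulr0 p01 oner_neq0.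
  have ta0 : 0 < t ^+ 2 * a by rewrite mulr_gt0// exprn_gt0.
  have : `|p 0 - p (t ^+ 2 * a)| < 1.
    apply: pe => //=; rewrite sub0r normrN gtr0_norm//.
    by apply: lt_le_trans te; rewrite expr2; nra.
  by rewrite p01; apply: contraTneq => ->; rewrite subr0 normr1 ltxx.
have : sin (t * (u - v)) * p (t ^+ 2 * a) = 0.
  rewrite mulrBr sinB mulrBl [X in X - _]mulrAC hs [X in _ - X]mulrAC hc.
  by ring.
move=> /eqP; rewrite mulf_eq0 (negbTE ptne0) orbF => /eqP s0.
have := sgr_sin tuv; rewrite s0 sgr0 => /esym/eqP.
by rewrite sgr_eq0 mulf_eq0 (negbTE uv0) gt_eqF.
Qed.

End right_continuous_at0.

(** * Quadratic forms on three lines of the plane *)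

Section quadratic_forms.
Context {R : realType}.
Implicit Types (L : {vspace 'rV[R]_2}).

Lemma line_gen L v : \dim L = 1%N -> v \in L -> v != 0 -> L = <[v]>%VS.
Proof.
move=> L1 vL v0; apply/esym/eqP.
by rewrite eqEdim dim_vline v0 L1 andbT -memvE.
Qed.

Lemma lines_sum L1 L2 : \dim L1 = 1%N -> \dim L2 = 1%N -> L1 <> L2 ->
  forall xi, exists2 u, u \in L1 & exists2 v, v \in L2 & xi = u + v.
Proof.
move=> d1 d2 L12 xi; suff /memv_addP : xi \in (L1 + L2)%VS by [].
suff -> : (L1 + L2)%VS = fullv by rewrite memvf.
apply/eqP; rewrite eqEdim subvf dimvf /=.
have := dimv_sum_cap L1 L2; rewrite d1 d2.
suff -> : \dim (L1 :&: L2) = 0%N by rewrite addn0 => ->.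
apply/eqP; rewrite dimv_eq0; apply: contra_notT L12 => cap0.
have : vpick (L1 :&: L2) \in (L1 :&: L2)%VS by exact: memv_pick.
rewrite memv_cap => /andP[p1 p2].
have p0 : vpick (L1 :&: L2) != 0 by rewrite vpick0.
by rewrite (line_gen d1 p1 p0) [RHS](line_gen d2 p2 p0).
Qed.

(** Decompose a nonzero vector of the third line as u0 + u1 along the first two.
    Both components are nonzero, as the lines are distinct, so they span the
    first two lines; and the form vanishing at u0, u1 and u0 + u1 means that its
    polar form vanishes at (u0, u1), hence everywhere. *)
Lemma quad_three_lines (L : 'I_3 -> {vspace 'rV[R]_2}) (S : 'M[R]_2) :
  (forall j, \dim (L j) = 1%N) -> injective L -> S^T = S ->
  (forall j v, v \in L j -> dot (v *m S) v = 0) ->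
  forall xi, dot (xi *m S) xi = 0.
Proof.
move=> dimL injL symS qL xi.
pose i0 : 'I_3 := inord 0; pose i1 : 'I_3 := inord 1; pose i2 : 'I_3 := inord 2.
have ne i j : (i < 3)%N -> (j < 3)%N -> i != j ->
    L (inord i) <> L (inord j).
  move=> i3 j3 ij /injL/(congr1 val); rewrite /= !inordK// => /eqP.
  by rewrite (negbTE ij).
have BC x y : dot (x *m S) y = dot (y *m S) x.
  rewrite /dot; have -> : y *m S *m x^T = (x *m S *m y^T)^T.
    by rewrite !trmx_mul trmxK symS mulmxA.
  by rewrite [RHS]mxE.
have qD x y : dot ((x + y) *m S) (x + y) =
    dot (x *m S) x + dot (y *m S) y + 2 * dot (x *m S) y.
  by rewrite mulmxDl dotDl !dotDr (BC y x); ring.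
have L01 : L i0 <> L i1 by exact: ne.
have [u0 u0L [u1 u1L u01]] := lines_sum (dimL i0) (dimL i1) L01 (vpick (L i2)).
have w0 : vpick (L i2) != 0 by rewrite vpick0 -dimv_eq0 dimL.
have wL : vpick (L i2) \in L i2 by exact: memv_pick.
have u0n0 : u0 != 0.
  apply/eqP => u00; move: u01; rewrite u00 add0r => wu1.
  suff : L i1 = L i2 by apply: ne.
  by rewrite (line_gen (dimL i2) wL w0) (line_gen (dimL i1) _ w0)// wu1.
have u1n0 : u1 != 0.
  apply/eqP => u10; move: u01; rewrite u10 addr0 => wu0.
  suff : L i0 = L i2 by apply: ne.
  by rewrite (line_gen (dimL i2) wL w0) (line_gen (dimL i0) _ w0)// wu0.
have B01 : dot (u0 *m S) u1 = 0.
  have := qL i2 _ wL; rewrite u01 qD (qL i0)// (qL i1)//.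
  by rewrite !add0r => /eqP; rewrite mulf_eq0 pnatr_eq0/= => /eqP.
have [x xL [y yL ->]] := lines_sum (dimL i0) (dimL i1) L01 xi.
rewrite qD (qL i0)// (qL i1)//.
move: xL yL; rewrite (line_gen (dimL i0) u0L u0n0) (line_gen (dimL i1) u1L u1n0).
move=> /vlineP[a ->] /vlineP[b ->].
by rewrite -scalemxAl dotZl dotZr B01 !mulr0 !addr0.
Qed.

Lemma quad_three_lines_eq (L : 'I_3 -> {vspace 'rV[R]_2}) (S T : 'M[R]_2)
    (a b : R) :
  (forall j, \dim (L j) = 1%N) -> injective L -> S^T = S -> T^T = T ->
  (forall j, a * dot (vpick (L j) *m S) (vpick (L j)) =
             b * dot (vpick (L j) *m T) (vpick (L j))) ->
  forall xi, a * dot (xi *m S) xi = b * dot (xi *m T) xi.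
Proof.
move=> dimL injL symS symT STL.
have qE v : dot (v *m (a *: S - b *: T)) v =
    a * dot (v *m S) v - b * dot (v *m T) v.
  by rewrite mulmxBr -!scalemxAr dotDl dotNl !dotZl.
have Q0 := @quad_three_lines L (a *: S - b *: T) dimL injL.
move=> xi; apply/eqP; rewrite -subr_eq0 -qE Q0//.
  by rewrite linearB !linearZ /= symS symT.
move=> j v; have w0 : vpick (L j) != 0 by rewrite vpick0 -dimv_eq0 dimL.
rewrite (line_gen (dimL j) (memv_pick _) w0) => /vlineP[c ->].
by rewrite -scalemxAl dotZl dotZr qE STL subrr !mulr0.
Qed.

End quadratic_forms.

(** * Elliptical distributions with equal marginals along three lines *)

Theorem corollary1 (R : realType) (L : 'I_3 -> {vspace 'rV[R]_2})
  (dimL : forall j : 'I_3, \dim (L j) = 1%N) (injL : injective L)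
  (P Q : probability (borel 'rV[R]_2) R)
  (ellP : elliptical P) (ellQ : elliptical Q)
  (PQ : forall (j : 'I_3) (B : set (borel (line_space (L j)))),
    measurable B -> marginal P (L j) B = marginal Q (L j) B) :
  forall A : set (borel 'rV[R]_2), measurable A -> P A = Q A.
Proof.
apply: char_fun_inj => xi.
have phiE j : {in L j, char_fun P =1 char_fun Q}.
  exact: char_fun_marginal (dimL j) (PQ j).
have [mu [S [p [[symS psdS] p01 p0 PE]]]] := elliptical_real ellP.
have [nu [T [r [[symT psdT] r01 r0 QE]]]] := elliptical_real ellQ.
have cE j v : v \in L j -> forall t,
    cos (t * dot mu v) * p (t ^+ 2 * dot (v *m S) v) =
    cos (t * dot nu v) * r (t ^+ 2 * dot (v *m T) v).
  move=> vL t; have := phiE j (t *: v) (memvZ t vL).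
  by rewrite PE QE -!scalemxAl !dotZl !dotZr !mulrA -expr2 => -[].
have sE j v : v \in L j -> forall t,
    sin (t * dot mu v) * p (t ^+ 2 * dot (v *m S) v) =
    sin (t * dot nu v) * r (t ^+ 2 * dot (v *m T) v).
  move=> vL t; have := phiE j (t *: v) (memvZ t vL).
  by rewrite PE QE -!scalemxAl !dotZl !dotZr !mulrA -expr2 => -[].
have muL j v : v \in L j -> dot mu v = dot nu v.
  by move=> vL; exact: (frequency_unique p01 p0 (psdS v) (cE j v vL) (sE j v vL)).
have mu_nu : dot mu xi = dot nu xi.
  have L01 : L ord0 <> L (lift ord0 ord0) by move/injL.
  have [x xL [y yL ->]] := lines_sum (dimL _) (dimL _) L01 xi.
  by rewrite !dotDr (muL _ _ xL) (muL _ _ yL).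
rewrite PE QE mu_nu.
suff -> : p (dot (xi *m S) xi) = r (dot (xi *m T) xi) by [].
pose a j := dot (vpick (L j) *m S) (vpick (L j)).
pose b j := dot (vpick (L j) *m T) (vpick (L j)).
have a0 j : 0 <= a j by exact: psdS.
have b0 j : 0 <= b j by exact: psdT.
(* The phases being equal, the cosine and sine equations at t = sqrt s combine
   into an equation between the amplitudes. *)
have prE j s : 0 <= s -> p (s * a j) = r (s * b j).
  move=> s0; have vL := memv_pick (L j).
  have := cE j _ vL (Num.sqrt s); have := sE j _ vL (Num.sqrt s).
  rewrite (muL j _ vL) sqr_sqrtr// -/(a j) -/(b j).
  have := cos2Dsin2 (Num.sqrt s * dot nu (vpick (L j))).
  move: (cos _) (sin _) => c d cd hs hc.
  by rewrite -[LHS]mul1r -[RHS]mul1r -cd !mulrDl !expr2 -!mulrA hs hc.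
have [/existsP[i /existsP[j ij]]|/existsPn] :=
    boolP [exists i, exists j, a i * b j != a j * b i].
  rewrite (common_scaling p0 (a0 i) (b0 i) (a0 j) (b0 j) (prE i) (prE j) ij)//.
  rewrite (common_scaling r0 (b0 i) (a0 i) (b0 j) (a0 j)
    (fun s s0 => esym (prE i s s0)) (fun s s0 => esym (prE j s s0)))//.
  - by rewrite p01 r01.
  - by rewrite eq_sym (mulrC (b j)) (mulrC (b i)).
move=> abE.
have {}abE i j : a i * b j = a j * b i.
  by apply/eqP; have /existsPn/(_ j)/negPn := abE i.
have [/existsP[k abk]|ab0] := boolP [exists k, a k + b k != 0].
  have TS : a k * dot (xi *m T) xi = b k * dot (xi *m S) xi.
    apply: (quad_three_lines_eq dimL injL symT symS) => j.
    by rewrite -/(a j) -/(b j) abE mulrC.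
  (* This symmetric choice of s yields q_S(xi) = s a_k and q_T(xi) = s b_k even
     when a_k or b_k is zero. *)
  pose s := (dot (xi *m S) xi + dot (xi *m T) xi) / (a k + b k).
  have s0 : 0 <= s by rewrite divr_ge0 ?addr_ge0.
  have -> : dot (xi *m S) xi = s * a k.
    apply: (mulIf abk); rewrite /s mulrAC divfK// mulrDl [_ * a k]mulrC.
    by rewrite [dot (xi *m T) xi * _]mulrC TS; ring.
  have -> : dot (xi *m T) xi = s * b k.
    apply: (mulIf abk); rewrite /s mulrAC divfK// mulrDl.
    by rewrite [dot (xi *m S) xi * _]mulrC -TS; ring.
  exact: prE.
(* Both forms vanish on the three lines, hence identically. *)
have z j : a j = 0 /\ b j = 0.
  have /existsPn/(_ j) := ab0; rewrite negbK paddr_eq0//.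
  by move=> /andP[/eqP-> /eqP->].
have S0 : 1 * dot (xi *m S) xi = 0 * dot (xi *m S) xi.
  apply: (quad_three_lines_eq dimL injL symS symS) => j.
  by rewrite -/(a j) (z j).1 !mulr0.
have T0 : 1 * dot (xi *m T) xi = 0 * dot (xi *m T) xi.
  apply: (quad_three_lines_eq dimL injL symT symT) => j.
  by rewrite -/(b j) (z j).2 !mulr0.
by move: S0 T0; rewrite !mul1r !mul0r => -> ->; rewrite p01 r01.
Qed.
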